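(* For $\alpha>1$ let $\Lambda_\alpha=\Gamma(\alpha/2)^2/\Gamma(\alpha)$ and let $K_\alpha$ be the bounded operator on $L^2(\mathbb R_+)$ given by $$(K_\alpha F)(x)=\int_0^\infty(xy)^{(\alpha-1)/2}\bigl(\zeta(1+x+y)^\alpha-1\bigr)F(y)\,dy.$$ Then $\|K_2\|>\Lambda_2=1$. In particular, the set $$E:=\{\alpha>1:\|K_\alpha\|>\Lambda_\alpha\}$$ is non-empty.
   Context: $\mathbb R_+=(0,\infty)$, $\zeta$ is the Riemann zeta function, and $\|\cdot\|$ is the operator norm on $L^2(\mathbb R_+)$. *)

(* Defs.v *)
From HB Require Import structures.
From mathcomp Require Import all_boot all_order all_algebra.
From mathcomp Require Import all_classical all_reals all_analysis.

Set Implicit Arguments.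
Unset Strict Implicit.
Unset Printing Implicit Defensive.

Import Order.TTheory GRing.Theory Num.Theory.
Import numFieldNormedType.Exports.

Local Open Scope classical_set_scope.
Local Open Scope ring_scope.

Section defs.
Context {R : realType}.

(* Euler's integral, for z > 0. *)
Definition Gamma (z : R) : R :=
  \int[lebesgue_measure]_(t in `]0%R, +oo[) (t `^ (z - 1) * expR (- t)).

(* The Dirichlet series sum_(n >= 1) n^-s; it represents the Riemann zeta
   function for real s > 1, the only range in which it is used below. *)
Definition zeta (s : R) : R := limn (series (riemannR s)).

(* Lebesgue measure on (0, oo), as a measure on R that ignores (-oo, 0]. *)
Definition mu_pos : {measure set (measurableTypeR R) -> \bar R} :=
  mrestr (@lebesgue_measure R) (measurable_itv `]0%R, +oo[).

(* An element of L^2(0, oo) is represented by a measurable function on R, up to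
   equality mu_pos-almost everywhere: its values on (-oo, 0] are irrelevant. *)
Definition L2 : {pred R -> R} := Lfun mu_pos 2%:E.

Definition norm2 (F : R -> R) : \bar R := 'N[mu_pos]_2%:E [EFin \o F].

Definition bounded_operator (T : (R -> R) -> R -> R) : Prop :=
  [/\ forall F, F \in L2 -> T F \in L2,
      forall (c : R) F G, F \in L2 -> G \in L2 ->
        T (fun x => c * F x + G x) = (fun x => c * T F x + T G x) %[ae mu_pos]
    & exists M : R, forall F, F \in L2 -> (norm2 (T F) <= M%:E * norm2 F)%E].

Definition opnorm (T : (R -> R) -> R -> R) : \bar R :=
  ereal_sup [set norm2 (T F) | F in [set F | F \in L2 /\ (norm2 F <= 1)%E]].

Definition kernelK (alpha x y : R) : R :=
  (x * y) `^ ((alpha - 1) / 2) * (zeta (1 + x + y) `^ alpha - 1).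

(* Extended by 0 to (-oo, 0], so that the representative is a measurable
   function on the whole of R. *)
Definition K (alpha : R) (F : R -> R) : R -> R :=
  (fun x => \int[lebesgue_measure]_(y in `]0%R, +oo[) (kernelK alpha x y * F y))
    \_ `]0%R, +oo[.

Definition Lambda (alpha : R) : R := Gamma (alpha / 2) ^+ 2 / Gamma alpha.

Definition E : set R :=
  [set alpha | 1 < alpha /\ ((Lambda alpha)%:E < opnorm (K alpha))%E].

End defs.

(* Main.v *)
(** Boundedness.  Comparing the Dirichlet series with an integral gives
    zeta(1 + s) <= 1 + 2^-s (1/2 + 1/s), hence zeta(1 + s)^alpha - 1 <= C s^-alpha for
    all s > 0, so the kernel is at most C (xy)^rho (x + y)^-alpha with
    rho = (alpha - 1) / 2.  Schur's test with the weight y^-rho applies, because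
    the integral of (x + y)^-alpha over y > 0 is x^(1 - alpha) / (alpha - 1).

    Lower bound for alpha = 2.  Let F(x) = (18/5) sqrt(x) exp(-9x/5), a unit
    vector.  With s = x + y,
      <K F, F> = (18/5)^2 / 6 * int_0^oo s^3 exp(-9s/5) (zeta(1 + s)^2 - 1) ds.
    Convexity of t^(-1-s) (trapezoidal rule on [2, oo)) and ln 2 <= 7/10 give
    zeta(1 + s) >= 1 + exp(-7s/10) (1/s + 1/4), and the resulting sum of Gamma
    integrals is about 1.003.  By Cauchy-Schwarz ||K F|| >= <K F, F> > 1 = ||F||. *)
Require Import Defs.
From mathcomp Require Import all_boot all_order all_algebra.
From mathcomp Require Import all_classical all_reals all_analysis.
From mathcomp Require Import measurable_realfun ring lra.

Set Implicit Arguments.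
Unset Strict Implicit.
Unset Printing Implicit Defensive.

Import Order.TTheory GRing.Theory Num.Theory.
Import numFieldNormedType.Exports.

Local Open Scope classical_set_scope.
Local Open Scope ring_scope.

Lemma powRN_tangent_le (R : realType) (x y s : R) : 0 < x -> 0 < y -> 0 <= s ->
  y `^ (- s) + s * (y - x) * y `^ (- s - 1) <= x `^ (- s).
Proof.
move=> x0 y0 s0.
have -> : y `^ (- s - 1) = y `^ (- s) / y.
  by rewrite powRD ?(gt_eqF y0) ?implybT// powR_inv1// ltW.
have -> : x `^ (- s) = y `^ (- s) * (x / y) `^ (- s).
  by rewrite -powRM ?divr_ge0 ?ltW// mulrCA divff ?mulr1// gt_eqF.
have -> : y `^ (- s) + s * (y - x) * (y `^ (- s) / y) = y `^ (- s) * (1 + s * (1 - x / y)).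
  by field; rewrite gt_eqF.
apply: ler_wpM2l; first exact: powR_ge0.
have xy0 : 0 < x / y by rewrite divr_gt0.
rewrite /powR gt_eqF// mulNr -mulrN.
apply: le_trans (expR_ge1Dx _); rewrite lerD2l; apply: ler_wpM2l => //.
have := expR_ge1Dx (ln (x / y)).
by rewrite lnK ?posrE//; lra.
Qed.

Lemma trapezoid_powR (R : realType) (m s : R) : 0 < m -> 0 < s ->
  m `^ (- s) / s - (m + 1) `^ (- s) / s <= (m `^ (- s - 1) + (m + 1) `^ (- s - 1)) / 2.
Proof.
move=> m0 s0.
pose c := m `^ (- s - 1).
pose w x := (c + x `^ (- s - 1)) * (x - m) / 2 + x `^ (- s) / s.
pose dw x := (c - x `^ (- s - 1) - (1 + s) * (x - m) * x `^ (- s - 1 - 1)) / 2.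
have dwE (x : R) : 0 < x -> is_derive x 1 w (dw x).
  move=> x0.
  pose f (z : R) := z `^ (- s - 1); pose g (z : R) := z `^ (- s).
  have d1 : is_derive x 1 f _ := is_derive1_powR (- s - 1) x0.
  have d2 : is_derive x 1 g _ := is_derive1_powR (- s) x0.
  rewrite (_ : w = (cst c + f) * (2^-1 \*: (id - cst m)) + s^-1 \*: g); last first.
    by apply/funext => z; rewrite /w /f /g !fctE /=; rewrite -![_ *: _]/(_ * _); ring.
  apply: is_derive_eq.
  rewrite -![_ *: _]/(_ * _) /dw !fctE /f /g -[(2^-1 \*: _) x]/(2^-1 * (x - m)); field.
  by rewrite gt_eqF.
have xm (x : R) : x \in `]m, +oo[ -> 0 < x.
  by rewrite in_itv/= andbT; exact: lt_trans.
have := @ger0_derive1_ndecry _ w m.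
have H1 (x : R) : x \in `]m, +oo[ -> derivable w x 1.
  by move=> /xm /dwE [].
have H2 (x : R) : x \in `]m, +oo[ -> 0 <= w^`()%classic x.
  move=> xm'; have x0 := xm _ xm'; rewrite derive1E; have [_ ->] := dwE x x0.
  rewrite /dw divr_ge0//.
  have := @powRN_tangent_le _ m x (1 + s) m0 x0.
  rewrite opprD [- 1 - s]addrC => /(_ (ltW (addr_gt0 ltr01 s0))).
  by rewrite /c; lra.
move=> /(_ H1 H2).
have wc : {within `[m, +oo[, continuous w}.
  apply: derivable_within_continuous => x; rewrite in_itv/= andbT => mx.
  by have [] := dwE x (lt_le_trans m0 mx).
move=> /(_ wc m (m + 1) (lexx _)).
rewrite lerDl ler01 => /(_ isT).
rewrite /w subrr mulr0 mul0r add0r.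
have -> : m + 1 - m = 1 by ring.
rewrite mulr1 /c; lra.
Qed.

Lemma powRN_natr_cvg0 (R : realType) (s : R) : 0 < s ->
  (n.+1%:R : R) `^ (- s) @[n --> \oo] --> (0 : R).
Proof.
move=> s0.
have -> : (fun n => (n.+1%:R : R) `^ (- s)) = (fun n => (harmonic n : R) `^ s) :> (R^nat).
  by apply/funext => n; rewrite /harmonic /= -powR_inv1 ?ler0n// -powRrM mulN1r.
have /cvg_at_rightP := powR_cvg0 s0.
by apply; split => [n|]; [rewrite harmonic_gt0|exact: cvg_harmonic].
Qed.

Lemma riemannRE (R : realType) (s : R) n : riemannR (1 + s) n = n.+1%:R `^ (- s - 1).
Proof. by rewrite /riemannR -powRN opprD addrC. Qed.

Lemma series_riemannR_le (R : realType) (s : R) n : 0 < s ->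
  series (riemannR (1 + s)) n.+2 <=
  1 + 2 `^ (- s) * (1 / 2 + 1 / s) - n.+2%:R `^ (- s) / s.
Proof.
move=> s0; elim: n => [|n IH].
  rewrite /series/= !big_nat_recr// big_nil !riemannRE powR1 /= (_ : 2 `^ (- s - 1) = 2 `^ (- s) / 2 :> R); first by rewrite mulrDr !mul1r; lra.
  by rewrite powRD ?pnatr_eq0 ?implybT// powR_inv1.
rewrite seriesSr; apply: (le_trans (lerD IH (lexx _))); rewrite riemannRE.
have := @powRN_tangent_le R n.+2%:R n.+3%:R s (ltr0Sn _ _) (ltr0Sn _ _) (ltW s0).
have -> : n.+3%:R - n.+2%:R = 1 :> R by rewrite -natr1; ring.
rewrite mulr1.
set a := _ `^ (- s); set b := _ `^ _; set c := _ `^ _ => H.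
rewrite -!addrA lerD2l lerD2l.
have : (a + s * b) / s <= c / s by rewrite ler_pM2r// invr_gt0.
rewrite mulrDl -mulrA mulrCA divff ?gt_eqF// mulr1; lra.
Qed.

Lemma series_riemannR_ge (R : realType) (s : R) n : 0 < s ->
  1 + 2 `^ (- s) * (1 / s + 1 / 4) - n.+2%:R `^ (- s) * (1 / s + 1 / 2) <=
  series (riemannR (1 + s)) n.+1.
Proof.
move=> s0.
suff : 1 + 2 `^ (- s) * (1 / s + 1 / 4) - n.+2%:R `^ (- s) / s - n.+2%:R `^ (- s - 1) / 2 <=
  series (riemannR (1 + s)) n.+1.
  apply: le_trans.
  have : n.+2%:R `^ (- s - 1) <= n.+2%:R `^ (- s) :> R.
    by apply: ler_powR; [rewrite ler1n|lra].
  by rewrite !mulrDr !mul1r; lra.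
elim: n => [|n IH].
  rewrite /series/= !big_nat_recr// big_nil riemannRE powR1 /=.
  rewrite (_ : 2 `^ (- s - 1) = 2 `^ (- s) / 2 :> R); first by rewrite mulrDr !mul1r; lra.
  by rewrite powRD ?pnatr_eq0 ?implybT// powR_inv1.
rewrite seriesSr; apply: le_trans (lerD IH (lexx _)); rewrite riemannRE.
have := trapezoid_powR (ltr0Sn R n.+1) s0.
rewrite natr1; lra.
Qed.

Lemma is_cvg_series_riemannR (R : realType) (s : R) : 0 < s ->
  cvgn (series (riemannR (1 + s))).
Proof.
move=> s0; apply: nondecreasing_is_cvgn.
  by apply: nondecreasing_series => n _ _; rewrite riemannRE powR_ge0.
exists (1 + 2 `^ (- s) * (1 / 2 + 1 / s)) => _ [n _ <-].
apply: le_trans (le_trans (series_riemannR_le n s0) _).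
  have : nondecreasing_seq (series (riemannR (1 + s))).
    by apply: nondecreasing_series => k _ _; rewrite riemannRE powR_ge0.
  by apply; rewrite (leq_trans (leqnSn n))// leqnSn.
by rewrite gerBl divr_ge0 ?powR_ge0// ltW.
Qed.

Lemma zeta_le (R : realType) (s : R) : 0 < s ->
  zeta (1 + s) <= 1 + 2 `^ (- s) * (1 / 2 + 1 / s).
Proof.
move=> s0; apply: limr_le; first exact: is_cvg_series_riemannR.
near=> n.
have [m nE] : exists m, n = m.+2.
  exists n.-2; have : (2 <= n)%N by near: n; exact: nbhs_infty_ge.
  by case: (n) => [|[|k]].
rewrite nE; apply: le_trans (series_riemannR_le m s0) _.
by rewrite gerBl divr_ge0 ?powR_ge0// ltW.
Unshelve. all: by end_near. Qed.

Lemma zeta_ge (R : realType) (s : R) : 0 < s ->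
  1 + 2 `^ (- s) * (1 / s + 1 / 4) <= zeta (1 + s).
Proof.
move=> s0.
pose u n : R := 1 + 2 `^ (- s) * (1 / s + 1 / 4) - n.+2%:R `^ (- s) * (1 / s + 1 / 2).
have cu : u n @[n --> \oo] --> 1 + 2 `^ (- s) * (1 / s + 1 / 4).
  rewrite -[X in _ --> X]subr0; apply: cvgB; first exact: cvg_cst.
  rewrite -(mul0r (1 / s + 1 / 2)); apply: cvgMr_tmp.
  rewrite (cvg_shiftS (fun n => n.+1%:R `^ (- s))).
  exact: powRN_natr_cvg0.
rewrite -(cvg_lim _ cu)//; apply: limr_le.
  by apply/cvg_ex; eexists; exact: cu.
apply: nearW => n; apply: le_trans (series_riemannR_ge n s0) _.
apply: nondecreasing_cvgn_le; last exact: is_cvg_series_riemannR.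
by apply: nondecreasing_series => k _ _; rewrite riemannRE powR_ge0.
Qed.

Lemma zeta_ge1 (R : realType) (s : R) : 0 < s -> 1 <= zeta (1 + s).
Proof.
move=> s0; apply: le_trans (zeta_ge s0).
by rewrite lerDl mulr_ge0 ?powR_ge0// addr_ge0// divr_ge0// ltW.
Qed.

Lemma zeta_powR_ge0 (R : realType) (alpha s : R) : 0 < alpha -> 0 < s ->
  0 <= zeta (1 + s) `^ alpha - 1.
Proof.
move=> a0 s0; have e1 : 1 `^ alpha = 1 :> R by rewrite powR1.
rewrite subr_ge0 -{1}e1; have z1 := zeta_ge1 s0.
by apply: ge0_ler_powR; rewrite ?nnegrE ?(ltW a0)// (le_trans _ z1).
Qed.

Lemma powR_le_powR2 (R : realType) (alpha s : R) : 0 < alpha -> 0 < s ->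
  s `^ alpha <= expR (alpha * ln (alpha / ln 2)) * 2 `^ s.
Proof.
move=> a0 s0; have l0 : 0 < ln 2 :> R by rewrite ln_gt0// ltr1n.
rewrite /powR !gt_eqF// -expRD ler_expR.
have -> : s = (s * ln 2 / alpha) * (alpha / ln 2).
  by field; rewrite !gt_eqF.
rewrite lnM ?posrE ?divr_gt0 ?mulr_gt0//.
rewrite mulrDr addrC lerD2l -ler_pdivlMl// .
have -> : alpha^-1 * (s * ln 2 / alpha * (alpha / ln 2) * ln 2) = s * ln 2 / alpha.
  by field; rewrite !gt_eqF.
have := expR_ge1Dx (ln (s * ln 2 / alpha)).
by rewrite lnK ?posrE ?divr_gt0 ?mulr_gt0//; lra.
Qed.

Lemma zeta_powR_le (R : realType) (alpha : R) : 0 < alpha ->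
  exists2 C : R, 0 < C &
    forall s : R, 0 < s -> zeta (1 + s) `^ alpha - 1 <= C * s `^ (- alpha).
Proof.
move=> a0.
pose C2 := 2 * alpha * expR alpha * expR (alpha * ln (alpha / ln 2)).
have C20 : 0 < C2 by rewrite !mulr_gt0 ?expR_gt0.
exists (3 `^ alpha + C2); first by rewrite addr_gt0 ?powR_gt0.
move=> s s0; have z1 := zeta_ge1 s0; have z0 := lt_le_trans ltr01 z1.
have z := zeta_le s0.
have sa : 0 < s `^ (- alpha) by rewrite powR_gt0.
have [s1|s1] := leP s 1.
  apply: (@le_trans _ _ (3 `^ alpha * s `^ (- alpha))); last first.
    by rewrite ler_pM2r// lerDl ltW.
  have -> : 3 `^ alpha * s `^ (- alpha) = (3 / s) `^ alpha.
    by rewrite powRM ?invr_ge0 ?(ltW s0)// -(powR_inv1 (ltW s0)) -powRrM mulN1r.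
  suff : zeta (1 + s) `^ alpha <= (3 / s) `^ alpha by lra.
  apply: ge0_ler_powR; rewrite ?nnegrE ?divr_ge0 ?(ltW s0) ?(ltW z0) ?(ltW a0)//.
  apply: le_trans z _.
  have h2 : 2 `^ (- s) <= 1 :> R 
    by rewrite -[leRHS](@powRr0 R 2); apply: ler_powR; [rewrite ler1n|rewrite oppr_le0 ltW].
  have i1 : 1 <= s^-1 by rewrite invf_ge1.
  have : 2 `^ (- s) * (1 / 2 + 1 / s) <= 1 * (1 / 2 + 1 / s).
    by apply: ler_wpM2r => //; rewrite addr_ge0 ?divr_ge0 ?ltW.
  by rewrite !mul1r; lra.
apply: (@le_trans _ _ (C2 * s `^ (- alpha))); last first.
  by rewrite ler_pM2r// lerDr powR_ge0.
pose v := 2 `^ (- s) * (1 / 2 + 1 / s).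
have h2 : 2 `^ (- s) <= 2^-1 :> R.
  by rewrite -(@powR_inv1 R 2)//; apply: ler_powR; [rewrite ler1n|rewrite lerN2 ltW].
have v2 : v <= 2 * 2 `^ (- s).
  rewrite /v mulrC ler_wpM2r ?powR_ge0//.
  have : s^-1 <= 1 by rewrite invf_le1// ltW.
  by rewrite !mul1r; lra.
have v1 : v <= 1 by move: v2; lra.
have v0 : 0 <= v by rewrite mulr_ge0 ?powR_ge0// addr_ge0// divr_ge0// ltW.
have z2 : zeta (1 + s) `^ alpha <= expR (alpha * v).
  rewrite {1}/powR gt_eqF// ler_expR ler_pM2l//.
  rewrite -ler_expR lnK ?posrE//; apply: le_trans z _; exact: expR_ge1Dx.
have e1 : expR (alpha * v) - 1 <= alpha * v * expR (alpha * v).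
  have := expR_ge1Dx (- (alpha * v)); rewrite expRN => h.
  have e0 := expR_gt0 (alpha * v).
  have : (1 - alpha * v) * expR (alpha * v) <= 1 by rewrite -ler_pdivlMr// mul1r.
  lra.
have e2 : expR (alpha * v) <= expR alpha by rewrite ler_expR ler_piMr// ltW.
apply: (@le_trans _ _ (alpha * (2 * 2 `^ (- s)) * expR alpha)).
  apply: (@le_trans _ _ (alpha * v * expR (alpha * v))); first by move: z2 e1; lra.
  apply: ler_pM; rewrite ?expR_ge0 ?ler_pM2l//.
  by rewrite mulr_ge0// ltW.
have -> : alpha * (2 * 2 `^ (- s)) * expR alpha = 2 * alpha * expR alpha * 2 `^ (- s) by ring.
rewrite /C2 -!mulrA ler_pM2l// ler_pM2l// ler_pM2l ?expR_gt0// !powRN.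
rewrite ler_pdivlMr ?powR_gt0// mulrC ler_pdivrMr ?powR_gt0//.
exact: powR_le_powR2.
Qed.

Lemma measurable_zeta1p (R : realType) :
  measurable_fun (`]0, +oo[ : set R) (fun s : R => zeta (1 + s)).
Proof.
pose h n (s : R) := series (riemannR (1 + s)) n.
apply: (@measurable_fun_cvg _ _ _ _ h).
  move=> n; apply: measurable_funTS; apply: measurable_sum => k.
  under eq_fun do rewrite riemannRE.
  apply: (measurableT_comp (measurable_powRr _)).
  exact: measurable_funB.
by move=> s; rewrite /= in_itv/= andbT; exact: is_cvg_series_riemannR.
Qed.

Lemma cauchy_schwarz_integral d (T : measurableType d) (R : realType)
    (mu : {measure set T -> \bar R}) (f g : T -> R) :
  measurable_fun setT f -> measurable_fun setT g ->
  (\int[mu]_x `|(f x * g x)%:E| * \int[mu]_x `|(f x * g x)%:E| <=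
   \int[mu]_x (f x ^+ 2)%:E * \int[mu]_x (g x ^+ 2)%:E)%E.
Proof.
move=> mf mg.
have sq (h : T -> R) : ('N[mu]_2%:E[EFin \o h] * 'N[mu]_2%:E[EFin \o h] =
    \int[mu]_x (h x ^+ 2)%:E)%E.
  have -> : (\int[mu]_x (h x ^+ 2)%:E = \int[mu]_x `|(EFin \o h) x| `^ 2)%E.
    apply: eq_integral => x _.
    by rewrite /= powR_mulrn// real_normK// num_real.
  rewrite -poweR_Lnorm ?pnatr_eq0//.
  have : (0 <= 'N[mu]_2%:E[EFin \o h])%E by exact: Lnorm_ge0.
  case: ('N[mu]_2%:E[EFin \o h])%E => [r| |]//; last by rewrite poweRyr// mulyy.
  by rewrite lee_fin => r0; rewrite poweR_EFin powR_mulrn// -EFinM expr2.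
have H := @hoelder _ _ _ mu f g 2 2 mf mg.
have {H} := H _ _ _; rewrite ltr0n => /(_ isT isT).
have -> : (2^-1 + 2^-1 = 1 :> R) by lra.
move=> /(_ erefl); rewrite Lnorm1 => H.
rewrite -!sq.
have -> : ('N[mu]_2%:E[EFin \o f] * 'N[mu]_2%:E[EFin \o f] * ('N[mu]_2%:E[EFin \o g] * 'N[mu]_2%:E[EFin \o g]) =
  ('N[mu]_2%:E[EFin \o f] * 'N[mu]_2%:E[EFin \o g]) * ('N[mu]_2%:E[EFin \o f] * 'N[mu]_2%:E[EFin \o g]))%E.
  by rewrite muleACA.
by apply: lee_pmul => //; apply: integral_ge0.
Qed.

Lemma schur_test d (T : measurableType d) (R : realType)
    (mu : {sigma_finite_measure set T -> \bar R})
    (k : T * T -> R) (p F : T -> R) (M : R) :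
  measurable_fun setT k -> measurable_fun setT p -> measurable_fun setT F ->
  (forall z, 0 <= k z) -> (forall x, 0 < p x) -> 0 <= M ->
  (forall x, \int[mu]_y (k (x, y) * p y)%:E <= (M * p x)%:E)%E ->
  (forall y, \int[mu]_x (k (x, y) * p x)%:E <= (M * p y)%:E)%E ->
  (\int[mu]_x ((\int[mu]_y `|(k (x, y) * F y)%:E|) * (\int[mu]_y `|(k (x, y) * F y)%:E|)) <=
   (M ^+ 2)%:E * \int[mu]_y (F y ^+ 2)%:E)%E.
Proof.
move=> mk mp mF k0 p0 M0 Hx Hy.
pose w (z : T * T) : \bar R := (M * p z.1 * (k z * (F z.2 ^+ 2 / p z.2)))%:E.
have mpi : measurable_fun setT (fun y => (p y)^-1).
  have -> : (fun y => (p y)^-1) = (fun y => p y `^ (-1)).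
    by apply/funext => y; rewrite powR_inv1// ltW.
  exact: (measurableT_comp (measurable_powR _)).
have p0' x : 0 <= p x by exact: ltW.
have pi0 x : 0 <= (p x)^-1 by rewrite invr_ge0.
have sq0 x : 0 <= F x ^+ 2 by exact: sqr_ge0.
have w0 z : (0 <= w z)%E.
  by rewrite lee_fin; do ![done | apply: mulr_ge0].
have mk1 x : measurable_fun setT (fun y => k (x, y)) by exact: measurableT_comp.
have mk2 y : measurable_fun setT (fun x => k (x, y)) by exact: measurableT_comp.
have mw : measurable_fun setT w.
  apply/measurable_EFinP; apply: measurable_funM.
    by apply: measurable_funM => //; exact: measurableT_comp.
  apply: measurable_funM => //; apply: measurable_funM.
    by apply: measurable_funX; exact: measurableT_comp.
  by apply: (measurableT_comp mpi).
apply: (@le_trans _ _ (\int[mu]_x \int[mu]_y w (x, y))%E).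
  apply: ge0_le_integral => //.
  - by move=> x _; apply: mule_ge0; apply: integral_ge0.
  - apply: emeasurable_funM;
      apply: (measurable_fun_fubini_tonelli_F (fun z => `|(k z * F z.2)%:E|%E)) => //;
      apply: measurableT_comp => //; apply/measurable_EFinP; apply: measurable_funM => //;
      exact: measurableT_comp.
  - exact: (measurable_fun_fubini_tonelli_F w).
  move=> x _.
  pose f y := Num.sqrt (k (x, y) * p y).
  pose g y := Num.sqrt (k (x, y) / p y) * F y.
  have fg y : k (x, y) * F y = f y * g y.
    rewrite /f /g mulrA -sqrtrM; last by rewrite mulr_ge0.
    rewrite (_ : _ * _ * _ = k (x, y) ^+ 2); last by field; rewrite gt_eqF.
    by rewrite sqrtr_sqr ger0_norm.
  have msqrt : measurable_fun setT (Num.sqrt : R -> R).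
    by apply: continuous_measurable_fun; exact: sqrt_continuous.
  have mf : measurable_fun setT f.
    by apply: (measurableT_comp msqrt); exact: measurable_funM.
  have mg : measurable_fun setT g.
    apply: measurable_funM => //.
    by apply: (measurableT_comp msqrt); exact: measurable_funM.
  under [in leLHS]eq_integral do rewrite fg.
  apply: le_trans (cauchy_schwarz_integral _ mf mg) _.
  have -> : (\int[mu]_y (f y ^+ 2)%:E = \int[mu]_y (k (x, y) * p y)%:E)%E.
    by apply: eq_integral => y _; rewrite /f sqr_sqrtr// mulr_ge0.
  have -> : (\int[mu]_y (g y ^+ 2)%:E = \int[mu]_y (k (x, y) * (F y ^+ 2 / p y))%:E)%E.
    apply: eq_integral => y _; rewrite /g exprMn sqr_sqrtr ?mulr_ge0//.
    by congr (_ %:E); field; rewrite gt_eqF.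
  have -> : (\int[mu]_y w (x, y) = (M * p x)%:E * \int[mu]_y (k (x, y) * (F y ^+ 2 / p y))%:E)%E.
    rewrite -ge0_integralZl//.
    - apply/measurable_EFinP; apply: measurable_funM => //; apply: measurable_funM => //.
      exact: measurable_funX.
    - by move=> y _; rewrite lee_fin; do ![done | apply: mulr_ge0].
    - by rewrite lee_fin mulr_ge0// ltW.
  apply: lee_pmul => //.
  - by apply: integral_ge0 => y _; rewrite lee_fin; do ![done | apply: mulr_ge0].
  - by apply: integral_ge0 => y _; rewrite lee_fin; do ![done | apply: mulr_ge0].
rewrite (fubini_tonelli w)//.
apply: (@le_trans _ _ (\int[mu]_y ((M ^+ 2)%:E * (F y ^+ 2)%:E))%E); last first.
  rewrite ge0_integralZl ?lee_fin ?sqr_ge0//.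
  - by apply/measurable_EFinP; exact: measurable_funX.
  - by move=> y _; rewrite lee_fin sqr_ge0.
apply: ge0_le_integral => //.
- by move=> y _; apply: integral_ge0.
- exact: (measurable_fun_fubini_tonelli_G w).
- by apply: emeasurable_funM => //; apply/measurable_EFinP; exact: measurable_funX.
move=> y _.
have -> : (\int[mu]_x w (x, y) = (M * (F y ^+ 2 / p y))%:E * \int[mu]_x (k (x, y) * p x)%:E)%E.
  rewrite -ge0_integralZl//.
  - by apply: eq_integral => x _; rewrite /w -EFinM /=; congr (_ %:E); ring.
  - by apply/measurable_EFinP; exact: measurable_funM.
  - by move=> x _; rewrite lee_fin; do ![done | apply: mulr_ge0].
  - by rewrite lee_fin; do ![done | apply: mulr_ge0].
apply: le_trans (lee_pmul _ _ (lexx _) (Hy y)) _.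
- by rewrite lee_fin; do ![done | apply: mulr_ge0].
- by apply: integral_ge0 => x _; rewrite lee_fin; do ![done | apply: mulr_ge0].
rewrite -!EFinM lee_fin le_eqVlt; apply/orP; left; apply/eqP; field.
by rewrite gt_eqF.
Qed.

Lemma integral_mu_pos (R : realType) (f : R -> \bar R) :
  measurable_fun setT f -> (forall x, 0 <= f x)%E ->
  (\int[mu_pos]_x f x = \int[lebesgue_measure]_(x in `]0%R, +oo[) f x)%E.
Proof.
move=> mf f0.
have mD : measurable (`]0%R, +oo[%classic : set (measurableTypeR R)) by exact: measurable_itv.
rewrite (@ge0_negligible_integral _ _ _ mu_pos setT (~` `]0%R, +oo[%classic))//.
- rewrite setTD setCK.
  by apply: eq_measure_integral => A mA AD /=; rewrite /mu_pos /mrestr setIidl.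
- exact: measurableC.
- by rewrite /mu_pos /= /mrestr setICl measure0.
Qed.

Lemma norm2E (R : realType) (F : R -> R) : measurable_fun setT F ->
  (norm2 F = (\int[lebesgue_measure]_(x in `]0%R, +oo[) (F x ^+ 2)%:E) `^ 2^-1)%E.
Proof.
move=> mF; rewrite /norm2 unlock; congr (_ `^ _)%E.
rewrite integral_mu_pos; last 2 first.
- apply: (measurableT_comp (measurable_poweR _)) => //.
  by apply: measurableT_comp => //; exact/measurable_EFinP.
- by move=> x; exact: poweR_ge0.
by apply: eq_integral => x _; rewrite /= powR_mulrn// real_normK// num_real.
Qed.

Lemma L2P (R : realType) (F : R -> R) :
  F \in L2 <-> measurable_fun setT F /\ (norm2 F < +oo)%E.
Proof.
split.
  by rewrite inE => /andP[]; rewrite inE/= => mF; rewrite inE.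
by move=> [mF nF]; rewrite inE; apply/andP; split; rewrite inE.
Qed.

Lemma L2_integral_sqr_lty (R : realType) (F : R -> R) : F \in L2 ->
  (\int[lebesgue_measure]_(x in `]0%R, +oo[) (F x ^+ 2)%:E < +oo)%E.
Proof.
move=> /L2P[mF]; rewrite norm2E//.
case: (\int[_]_(_ in _) _)%E => [r _| |//]; first exact: ltry.
by rewrite poweRyr// invr_eq0 pnatr_eq0.
Qed.

(* Cut off to the open quadrant: [zeta] is a junk value when [1 + x + y <= 1],
   and Tonelli is applied on all of [R * R]. *)
Definition kernelK0 (R : realType) (alpha : R) (z : R * R) : R :=
  if (0 < z.1) && (0 < z.2) then kernelK alpha z.1 z.2 else 0.

Lemma kernelK0E (R : realType) (alpha x y : R) : 0 < x -> 0 < y ->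
  kernelK0 alpha (x, y) = kernelK alpha x y.
Proof. by move=> x0 y0; rewrite /kernelK0 x0 y0. Qed.

Lemma kernelK0_ge0 (R : realType) (alpha : R) (z : R * R) : 0 < alpha ->
  0 <= kernelK0 alpha z.
Proof.
move=> a0; rewrite /kernelK0; case: ifP => // /andP[x0 y0].
by rewrite /kernelK -addrA mulr_ge0 ?powR_ge0// zeta_powR_ge0// addr_gt0.
Qed.

Lemma kernelK0_sym (R : realType) (alpha x y : R) :
  kernelK0 alpha (x, y) = kernelK0 alpha (y, x).
Proof. by rewrite /kernelK0 /kernelK/= andbC mulrC -!addrA [x + y]addrC [y * x]mulrC mulrC. Qed.

Lemma measurable_kernelK0 (R : realType) (alpha : R) :
  measurable_fun setT (kernelK0 alpha).
Proof.
pose D : set R := `]0%R, +oo[%classic.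
have mD : measurable D by exact: measurable_itv.
pose phi := (fun s : R => zeta (1 + s) `^ alpha - 1) \_ D.
have mphi : measurable_fun setT phi.
  apply/(measurable_restrictT _ mD); apply: measurable_funB => //.
  by apply: (measurableT_comp (measurable_powR _)); exact: measurable_zeta1p.
rewrite (_ : kernelK0 alpha = (fun z : R * R =>
   \1_(D `*` D) z * ((z.1 * z.2) `^ ((alpha - 1) / 2) * phi (z.1 + z.2)))).
  apply: measurable_funM; first by apply: measurable_indic; exact: measurableX.
  apply: measurable_funM.
    by apply: (measurableT_comp (measurable_powR _)); exact: measurable_funM.
  by apply: (measurableT_comp mphi); exact: measurable_funD.
apply/funext => -[x y]; rewrite /kernelK0 indicE in_setX /=.
have DE (z : R) : (z \in D) = (0 < z) by rewrite mem_setE in_itv/= andbT.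
rewrite !DE; case: ifP => [/andP[x0 y0]|_]; last by rewrite mul0r.
by rewrite mul1r /phi patchE DE (addr_gt0 x0 y0) addrA.
Qed.

Lemma integral_powR_add (R : realType) (x alpha : R) : 0 < x -> 1 < alpha ->
  (\int[lebesgue_measure]_(y in `]0%R, +oo[) ((x + y) `^ (- alpha))%:E =
   (x `^ (1 - alpha) / (alpha - 1))%:E)%E.
Proof.
move=> x0 a1.
have ap : alpha - 1 != 0 by rewrite gt_eqF// subr_gt0.
pose f (y : R) := (x + y) `^ (- alpha).
pose F (y : R) := - ((alpha - 1)^-1 * (x + y) `^ (1 - alpha)).
have sh (y : R) : is_derive y 1 (fun y => x + y) (1 : R).
  by rewrite (_ : (fun y => x + y) = cst x + id)//; apply: is_derive_eq; rewrite add0r.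
have dF (y : R) : 0 < x + y -> is_derive y 1 F (f y).
  move=> xy0.
  pose G (z : R) := (x + z) `^ (1 - alpha).
  have h : is_derive y 1 G _ := is_derive1_comp (is_derive1_powR (1 - alpha) xy0) (sh y).
  rewrite (_ : F = - ((alpha - 1)^-1 \*: G)); last by apply/funext.
  apply: is_derive_eq.
  rewrite -[_ *: _]/(_ * _) /f addrAC subrr sub0r mulr1 mulrA -mulrN mulrN -mulNr -mulrN opprB.
  by rewrite mulVf// mul1r.
have df (y : R) : 0 < x + y -> derivable f y 1.
  move=> xy0.
  by have [] := is_derive1_comp (is_derive1_powR (- alpha) xy0) (sh y).
have xy (y : R) : 0 <= y -> 0 < x + y by move=> y0; rewrite ltr_wpDr.
have dF1 (y : R) : 0 <= y -> derivable F y 1 by move=> /xy /dF[].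
rewrite integral_itv_obnd_cbnd; last first.
  apply/measurable_EFinP; apply: measurable_funTS.
  by apply: (measurableT_comp (measurable_powR _)); exact: measurable_funD.
rewrite (@ge0_continuous_FTC2y _ f F 0 0).
- by rewrite sub0e -EFinN /F addr0 opprK mulrC.
- by move=> y _; exact: powR_ge0.
- apply: derivable_within_continuous => y; rewrite in_itv/= andbT => y0.
  by apply: df; exact: xy.
- rewrite -oppr0; apply: cvgN; rewrite -(mulr0 (alpha - 1)^-1); apply: cvgMl_tmp.
  apply/cvgrPdist_le => e e0; near=> y.
  rewrite sub0r normrN ger0_norm ?powR_ge0// -opprB powRN.
  rewrite -[leRHS]invrK lef_pV2 ?posrE ?invr_gt0// ?powR_gt0//; last first.
    by apply: xy; near: y; exact: nbhs_pinfty_ge.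
  have -> : e^-1 = (e `^ (- (alpha - 1)^-1)) `^ (alpha - 1).
    by rewrite -powRrM mulNr mulVf// powR_inv1// ltW.
  have Ay : e `^ (- (alpha - 1)^-1) <= y.
    by near: y; apply: nbhs_pinfty_ge; exact: num_real.
  apply: ge0_ler_powR.
  - by rewrite subr_ge0 ltW.
  - by rewrite nnegrE powR_ge0.
  - by rewrite nnegrE (le_trans (powR_ge0 _ _) (le_trans Ay _))// lerDr ltW.
  - by rewrite (le_trans Ay)// lerDr ltW.
- by move=> y /ltW; exact: dF1.
- have : {for 0, continuous F}.
    by apply: differentiable_continuous; apply/derivable1_diffP; exact: dF1.
  exact: cvg_at_right_filter.
- move=> y; rewrite in_itv/= andbT => y0; rewrite derive1E.
  by have [_ ->] := dF y (xy y (ltW y0)).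
Unshelve. all: by end_near. Qed.

(* Schur's test with the weight [y^-rho], [rho = (alpha - 1) / 2]: as the kernel is at
   most [C (xy)^rho (x + y)^-alpha], this weight cancels the power of [y]. It is
   written with [expR] and [ln] to be positive on the whole line. *)
Lemma kernelK0_schur (R : realType) (alpha : R) : 1 < alpha ->
  exists2 M : R, 0 <= M & forall x,
    (\int[lebesgue_measure]_y
      (kernelK0 alpha (x, y) * expR (- ((alpha - 1) / 2) * ln y))%:E <=
      (M * expR (- ((alpha - 1) / 2) * ln x))%:E)%E.
Proof.
move=> a1; have a0 := lt_trans ltr01 a1; have a10 : 0 < alpha - 1 by rewrite subr_gt0.
set rho := (alpha - 1) / 2.
have [C C0 HC] := zeta_powR_le a0.
exists (C / (alpha - 1)); first by rewrite divr_ge0 ?ltW.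
move=> x; have [x0|x0] := leP x 0.
  rewrite integral0_eq ?lee_fin ?mulr_ge0 ?expR_ge0 ?invr_ge0 ?(ltW C0) ?(ltW a10)//.
  by move=> y _; rewrite /kernelK0/= ltNge x0 mul0r.
have mk : measurable_fun setT (fun y => kernelK0 alpha (x, y)).
  by apply: measurableT_comp => //; exact: measurable_kernelK0.
have mp : measurable_fun setT (fun y : R => expR (- rho * ln y)).
  by apply: measurableT_comp => //; exact: measurable_funM.
rewrite (_ : \int[_]_y _ = \int[lebesgue_measure]_(y in `]0%R, +oo[) (kernelK0 alpha (x, y) * expR (- rho * ln y))%:E)%E; last first.
  rewrite [RHS]integral_mkcond; apply: eq_integral => y _.
  rewrite patchE mem_setE in_itv/= andbT; case: ifPn => // y0.
  by rewrite /kernelK0 /= (negbTE y0) andbF mul0r.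
apply: (@le_trans _ _ (\int[lebesgue_measure]_(y in `]0%R, +oo[) ((C * x `^ rho)%:E * ((x + y) `^ (- alpha))%:E))%E).
  apply: ge0_le_integral => //.
  - by move=> y _; rewrite lee_fin mulr_ge0 ?kernelK0_ge0 ?expR_ge0.
  - by apply/measurable_EFinP; apply: measurable_funTS; exact: measurable_funM.
  - apply/measurable_EFinP; apply: measurable_funTS; apply: measurable_funM => //.
    by apply: (measurableT_comp (measurable_powR _)); exact: measurable_funD.
  move=> y; rewrite /= in_itv/= andbT => y0.
  rewrite -EFinM lee_fin kernelK0E// /kernelK -addrA.
  have -> : expR (- rho * ln y) = y `^ (- rho) by rewrite /powR gt_eqF.
  have yy : y `^ rho * y `^ (- rho) = 1.
    by rewrite -powRD ?(gt_eqF y0) ?implybT// subrr powRr0.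
  rewrite (powRM _ (ltW x0) (ltW y0)) -/rho [leLHS](_ : _ = x `^ rho * (zeta (1 + (x + y)) `^ alpha - 1) * (y `^ rho * y `^ (- rho))); last by ring.
  rewrite yy mulr1 [C * _]mulrC -mulrA ler_pM2l ?powR_gt0//.
  by apply: HC; exact: addr_gt0.
rewrite ge0_integralZl//; last 3 first.
- apply/measurable_EFinP; apply: measurable_funTS.
  by apply: (measurableT_comp (measurable_powR _)); exact: measurable_funD.
- by move=> y _; rewrite lee_fin powR_ge0.
- by rewrite lee_fin mulr_ge0 ?powR_ge0// ltW.
rewrite integral_powR_add// -EFinM lee_fin.
have -> : expR (- rho * ln x) = x `^ (- rho) by rewrite /powR gt_eqF.
have -> : - rho = rho + (1 - alpha) by rewrite /rho; field.
rewrite [x `^ (rho + _)]powRD ?(gt_eqF x0) ?implybT//.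
by rewrite le_eqVlt; apply/orP; left; apply/eqP; ring.
Qed.

Lemma ae_mu_pos (R : realType) (P : R -> Prop) :
  {ae lebesgue_measure, forall x : R, 0 < x -> P x} -> {ae mu_pos, forall x, P x}.
Proof.
move=> [N [mN N0 PN]].
have mD : measurable (`]0%R, +oo[%classic : set (measurableTypeR R)) by exact: measurable_itv.
exists (N `|` ~` `]0%R, +oo[%classic); split.
- by apply: measurableU => //; exact: measurableC.
- rewrite /mu_pos /= /mrestr setIUl setICl setU0.
  apply/eqP; rewrite -measure_le0 -[leRHS]N0; apply: le_measure; rewrite ?inE//.
  exact: measurableI.
- move=> x /= nP; have [x0|x0] := ltP 0 x; last first.
    by right; rewrite in_itv/= andbT; apply/negP; rewrite -leNgt.
  by left; apply: PN => /= /(_ x0).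
Qed.

Definition absK (R : realType) (alpha : R) (F : R -> R) (x : R) : \bar R :=
  (\int[lebesgue_measure]_y `|(kernelK0 alpha (x, y) * F y)%:E|)%E.

Lemma measurable_kernelK0M (R : realType) (alpha : R) (F : R -> R) :
  measurable_fun setT F ->
  measurable_fun setT (fun z : R * R => (kernelK0 alpha z * F z.2)%:E).
Proof.
move=> mF; apply/measurable_EFinP; apply: measurable_funM.
  exact: measurable_kernelK0.
exact: measurableT_comp.
Qed.

Lemma measurable_absK (R : realType) (alpha : R) (F : R -> R) :
  measurable_fun setT F -> measurable_fun setT (absK alpha F).
Proof.
move=> mF.
apply: (@measurable_fun_fubini_tonelli_F _ _ _ _ R (@lebesgue_measure R)
  (fun z : R * R => `|(kernelK0 alpha z * F z.2)%:E|%E)) => //.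
by apply: measurableT_comp => //; exact: measurable_kernelK0M.
Qed.

Lemma absK_ge0 (R : realType) (alpha : R) (F : R -> R) x : (0 <= absK alpha F x)%E.
Proof. by apply: integral_ge0 => y _. Qed.

Lemma absK_le (R : realType) (alpha : R) : 1 < alpha ->
  exists2 M : R, 0 <= M & forall F : R -> R, measurable_fun setT F ->
    (\int[lebesgue_measure]_x (absK alpha F x * absK alpha F x) <=
     (M ^+ 2)%:E * \int[lebesgue_measure]_(y in `]0%R, +oo[) (F y ^+ 2)%:E)%E.
Proof.
move=> a1; have a0 := lt_trans ltr01 a1.
have [M M0 HM] := kernelK0_schur a1; exists M => // F mF.
have mD : measurable (`]0%R, +oo[%classic : set (measurableTypeR R)) by exact: measurable_itv.
pose G : R -> R := F \_ `]0%R, +oo[%classic.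
have mG : measurable_fun setT G.
  by apply: (measurable_restrictT _ mD).1; exact: measurable_funTS.
have GE (y : R) : G y = if 0 < y then F y else 0.
  by rewrite /G patchE mem_setE in_itv/= andbT.
have mp : measurable_fun setT (fun y : R => expR (- ((alpha - 1) / 2) * ln y)).
  by apply: measurableT_comp => //; exact: measurable_funM.
have := @schur_test _ _ _ lebesgue_measure (kernelK0 alpha) _ G M
  (@measurable_kernelK0 R alpha) mp mG.
move=> /(_ (fun z => kernelK0_ge0 z a0) (fun x => expR_gt0 _) M0 HM) H.
have {H} := H _.
have -> : (\int[lebesgue_measure]_y (G y ^+ 2)%:E = \int[lebesgue_measure]_(y in `]0%R, +oo[) (F y ^+ 2)%:E)%E.
  rewrite [RHS]integral_mkcond; apply: eq_integral => y _.
  by rewrite GE patchE mem_setE in_itv/= andbT; case: ifP; rewrite ?expr0n.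
have AE x : (\int[lebesgue_measure]_y `|(kernelK0 alpha (x, y) * G y)%:E| = absK alpha F x)%E.
  apply: eq_integral => y _; rewrite GE; case: ifPn => // y0.
  by rewrite /kernelK0/= (negbTE y0) andbF !mul0r.
have -> : (\int[lebesgue_measure]_x (absK alpha F x * absK alpha F x) =
    \int[lebesgue_measure]_x ((\int[lebesgue_measure]_y `|(kernelK0 alpha (x, y) * G y)%:E|) *
      (\int[lebesgue_measure]_y `|(kernelK0 alpha (x, y) * G y)%:E|)))%E.
  by apply: eq_integral => x _; rewrite AE.
apply => y; apply: le_trans (HM y).
rewrite le_eqVlt; apply/orP; left; apply/eqP; apply: eq_integral => x _.
by rewrite (kernelK0_sym alpha x y).
Qed.

Lemma KE (R : realType) (alpha : R) (F : R -> R) :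
  K alpha F = (fun x => fine (\int[lebesgue_measure]_y (kernelK0 alpha (x, y) * F y)%:E)).
Proof.
apply/funext => x; rewrite /K patchE mem_setE in_itv/= andbT; case: ifPn => x0.
  rewrite /Rintegral integral_mkcond; congr fine; apply: eq_integral => y _.
  rewrite patchE mem_setE in_itv/= andbT; case: ifPn => y0; first by rewrite kernelK0E.
  by rewrite /kernelK0/= (negbTE y0) andbF mul0r.
rewrite integral0_eq// => y _.
by rewrite /kernelK0/= (negbTE x0) mul0r.
Qed.

Lemma measurable_K (R : realType) (alpha : R) (F : R -> R) :
  measurable_fun setT F -> measurable_fun setT (K alpha F).
Proof.
move=> mF; rewrite KE; apply: (measurableT_comp (fine_measurable measurableT)).
pose f (z : R * R) := (kernelK0 alpha z * F z.2)%:E.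
have mf : measurable_fun setT f by exact: measurable_kernelK0M.
rewrite (_ : (fun x => _) = (fun x => \int[lebesgue_measure]_y f^\+ (x, y) - \int[lebesgue_measure]_y f^\- (x, y))%E); last first.
  apply/funext => x; rewrite [LHS]integralE.
  by congr (_ - _)%E; apply: eq_integral => y _; rewrite ?funeposE ?funenegE.
apply: emeasurable_funB.
- apply: (@measurable_fun_fubini_tonelli_F _ _ _ _ R (@lebesgue_measure R) f^\+%E) => //; exact: measurable_funepos.
- apply: (@measurable_fun_fubini_tonelli_F _ _ _ _ R (@lebesgue_measure R) f^\-%E) => //; exact: measurable_funeneg.
Qed.

Lemma measurable_kernelK0_section (R : realType) (alpha x : R) (F : R -> R) :
  measurable_fun setT F ->
  measurable_fun setT (fun y => (kernelK0 alpha (x, y) * F y)%:E).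
Proof.
move=> mF; apply/measurable_EFinP; apply: measurable_funM => //.
by apply: measurableT_comp => //; exact: measurable_kernelK0.
Qed.

Lemma K_le_absK (R : realType) (alpha x : R) (F : R -> R) :
  measurable_fun setT F -> (`|(K alpha F x)%:E| <= absK alpha F x)%E.
Proof.
move=> mF; rewrite KE.
apply: (@le_trans _ _ `|\int[lebesgue_measure]_y (kernelK0 alpha (x, y) * F y)%:E|%E).
  by case: (\int[_]_y _)%E => [r| |]//=; rewrite ?normr0 ?leey.
by apply: le_abse_integral => //; exact: measurable_kernelK0_section.
Qed.

Lemma absK_integrable (R : realType) (alpha x : R) (F : R -> R) :
  measurable_fun setT F -> (absK alpha F x < +oo)%E ->
  lebesgue_measure.-integrable setT (fun y => (kernelK0 alpha (x, y) * F y)%:E).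
Proof.
by move=> mF h; apply/integrableP; split => //; exact: measurable_kernelK0_section.
Qed.

Lemma kernelK_integrable (R : realType) (alpha x : R) (F : R -> R) : 0 < x ->
  measurable_fun setT F -> (absK alpha F x < +oo)%E ->
  lebesgue_measure.-integrable `]0%R, +oo[ (fun y => (kernelK alpha x y * F y)%:E).
Proof.
move=> x0 mF h.
have mD : measurable (`]0%R, +oo[%classic : set (measurableTypeR R)) by exact: measurable_itv.
refine (eq_integrable mD _ _ _ (integrableS measurableT mD (@subsetT _ _) (absK_integrable mF h))).
by move=> y; rewrite inE/= in_itv/= andbT => y0; rewrite kernelK0E.
Qed.

Lemma ae_absK_lty (R : realType) (alpha : R) (F : R -> R) : 1 < alpha -> F \in L2 ->
  {ae lebesgue_measure, forall x : R, (absK alpha F x < +oo)%E}.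
Proof.
move=> a1 F2; have [mF _] := (L2P F).1 F2.
have [M M0 HM] := absK_le a1.
have mA := measurable_absK alpha mF.
have mAA : measurable_fun setT (fun x => absK alpha F x * absK alpha F x)%E.
  exact: emeasurable_funM.
have : lebesgue_measure.-integrable setT (fun x => absK alpha F x * absK alpha F x)%E.
  apply/integrableP; split => //.
  under eq_integral do rewrite gee0_abs ?mule_ge0 ?absK_ge0//.
  apply: le_lt_trans (HM F mF) _.
  by rewrite lte_mul_pinfty ?lee_fin ?sqr_ge0// L2_integral_sqr_lty.
move=> /(integrable_ae measurableT); apply: filterS => x /(_ I) /=.
have := absK_ge0 alpha F x; case: (absK alpha F x) => [r| |]//; first by rewrite ltry.
Qed.

Lemma norm2_K_le (R : realType) (alpha : R) : 1 < alpha ->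
  exists2 M : R, 0 <= M & forall F : R -> R, measurable_fun setT F ->
    (norm2 (K alpha F) <= M%:E * norm2 F)%E.
Proof.
move=> a1; have [M M0 HM] := absK_le a1; exists M => // F mF.
have mK := measurable_K alpha mF; have mA := measurable_absK alpha mF.
rewrite !norm2E//.
have I0 : (0 <= \int[lebesgue_measure]_(x in `]0%R, +oo[) (F x ^+ 2)%:E)%E.
  by apply: integral_ge0 => x _; rewrite lee_fin sqr_ge0.
have <- : ((M ^+ 2)%:E `^ 2^-1 = M%:E)%E.
  by rewrite poweR_EFin powR12_sqrt ?sqr_ge0// sqrtr_sqr ger0_norm.
rewrite -poweRM//; last by rewrite lee_fin sqr_ge0.
have h2 : 0 <= 2^-1 :> R by rewrite invr_ge0.
apply: (gt0_ler_poweR h2).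
- by rewrite in_itv/= leey andbT; apply: integral_ge0 => x _; rewrite lee_fin sqr_ge0.
- by rewrite in_itv/= leey andbT mule_ge0// lee_fin sqr_ge0.
apply: le_trans (HM F mF).
have mD : measurable (`]0%R, +oo[%classic : set (measurableTypeR R)) by exact: measurable_itv.
apply: (@le_trans _ _ (\int[lebesgue_measure]_x (K alpha F x ^+ 2)%:E)%E).
  apply: ge0_subset_integral => //; last by move=> x _; rewrite lee_fin sqr_ge0.
  by apply/measurable_EFinP; exact: measurable_funX.
apply: ge0_le_integral => //.
- by move=> x _; rewrite lee_fin sqr_ge0.
- by apply/measurable_EFinP; exact: measurable_funX.
- exact: emeasurable_funM.
move=> x _; rewrite -real_normK ?num_real// expr2 EFinM -abse_EFin.
by apply: lee_pmul => //; exact: K_le_absK.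
Qed.

Lemma K_bounded (R : realType) (alpha : R) : 1 < alpha -> bounded_operator (K alpha).
Proof.
move=> a1; have [M M0 HM] := norm2_K_le a1; split.
- move=> F F2; have [mF nF] := (L2P F).1 F2; apply/L2P; split; first exact: measurable_K.
  by apply: le_lt_trans (HM F mF) _; rewrite lte_mul_pinfty.
- move=> c F G F2 G2; have [mF _] := (L2P F).1 F2; have [mG _] := (L2P G).1 G2.
  apply: ae_mu_pos.
  have FF := @ae_filter_ringOfSetsType _ _ _ (@lebesgue_measure R).
  apply: filterS2 (ae_absK_lty a1 F2) (ae_absK_lty a1 G2) => x Fx Gx x0 _.
  rewrite /K !patchE mem_setE in_itv/= x0 /=.
  have iF := kernelK_integrable x0 mF Fx; have iG := kernelK_integrable x0 mG Gx.
  have mD : measurable (`]0%R, +oo[%classic : set (measurableTypeR R)) by exact: measurable_itv.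
  rewrite -RintegralZl// -RintegralD//.
    by apply: eq_Rintegral => y _; ring.
  rewrite (_ : EFin \o _ = (fun y => c%:E * (kernelK alpha x y * F y)%:E)%E); last first.
    by apply/funext => y; rewrite /= EFinM.
  exact: integrableZl.
- by exists M => F /L2P[mF _]; exact: HM.
Qed.

Lemma cvg_exprM_expRN (R : realType) (k : nat) (p : R) : 0 < p ->
  s ^+ k * expR (- (p * s)) @[s --> +oo] --> (0 : R).
Proof.
move=> p0.
pose C : R := k.+1`!%:R / p ^+ k.+1.
have C0 : 0 < C by rewrite divr_gt0 ?exprn_gt0// ltr0n fact_gt0.
apply/cvgrPdist_le => e e0; near=> s.
have s0 : 0 < s by near: s; exact: nbhs_pinfty_gt.
have se : C / e <= s by near: s; apply: nbhs_pinfty_ge; exact: num_real.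
rewrite sub0r normrN ger0_norm; last by rewrite mulr_ge0 ?expR_ge0// exprn_ge0// ltW.
have h : (p * s) ^+ k.+1 / k.+1`!%:R <= expR (p * s).
  apply: le_trans (expR_ge1Dxn k (ltW (mulr_gt0 p0 s0))); lra.
apply: (@le_trans _ _ (C / s)); last first.
  by rewrite ler_pdivrMr// mulrC -ler_pdivrMr.
rewrite expRN ler_pdivrMr ?expR_gt0//.
apply: (@le_trans _ _ (C / s * ((p * s) ^+ k.+1 / k.+1`!%:R))); last first.
  by rewrite ler_pM2l// divr_gt0.
rewrite le_eqVlt; apply/orP; left; apply/eqP.
rewrite /C exprMn [s ^+ k.+1]exprS; field.
rewrite pnatr_eq0 -lt0n fact_gt0 (gt_eqF s0) /= expf_neq0//.
by rewrite gt_eqF.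
Unshelve. all: by end_near. Qed.

Lemma exprM_expRN_primitive (R : realType) (k : nat) (p : R) : 0 < p ->
  exists P : R -> R, [/\ forall s : R, is_derive s 1 P (s ^+ k * expR (- (p * s))),
    P s @[s --> +oo] --> (0 : R) & P 0 = - (k`!%:R / p ^+ k.+1)].
Proof.
move=> p0; have pn0 : p != 0 by rewrite gt_eqF.
pose E (s : R) := expR (- (p * s)).
have dE (s : R) : is_derive s 1 E (- p * E s).
  have h1 : is_derive s 1 (fun s : R => - (p * s)) (- p).
    rewrite (_ : (fun s : R => - (p * s)) = - (p \*: id)); last by apply/funext.
    by apply: is_derive_eq; rewrite -[_ *: _]/(_ * _) mulr1.
  have := @is_derive1_comp R expR (fun s => - (p * s)) s _ _ (is_derive_expR (- (p * s))) h1.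
  by rewrite mulrC.
elim: k => [|k [P [dP P0 PE]]].
  exists (fun s => - (p^-1 * E s)); split.
  - move=> s.
    rewrite (_ : (fun s => _) = - (p^-1 \*: E)); last by apply/funext.
    apply: is_derive_eq; rewrite -[_ *: _]/(_ * _) expr0 mulNr mulrN opprK mulrA mulVf//.
  - rewrite -oppr0; apply: cvgN; rewrite -(mulr0 p^-1); apply: cvgMl_tmp.
    have := @cvg_exprM_expRN _ 0 _ p0.
    by under eq_cvg do rewrite expr0 mul1r.
  - by rewrite /E mulr0 oppr0 expR0 mulr1 fact0 expr1 div1r.
pose G (s : R) := s ^+ k.+1.
exists (fun s => - (p^-1 * (G s * E s)) + k.+1%:R / p * P s); split.
- move=> s.
  have dG : is_derive s 1 G (k.+1%:R * s ^+ k).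
    rewrite /G (_ : (fun s : R => s ^+ k.+1) = id ^+ k.+1); last by apply/funext => z; rewrite fctE.
    by apply: is_derive_eq; rewrite -[_ *: _]/(_ * _) /= mulr1 -mulr_natl.
  rewrite (_ : (fun s => _) = - (p^-1 \*: (G * E)) + (k.+1%:R / p) \*: P); last by apply/funext.
  apply: is_derive_eq; rewrite -![_ *: _]/(_ * _) -/(E s) /G; field.
  exact: pn0.
- rewrite -[X in _ --> X](_ : - (p^-1 * 0) + k.+1%:R / p * 0 = 0); last by rewrite !mulr0 oppr0 addr0.
  apply: cvgD; last by apply: cvgMl_tmp.
  by apply: cvgN; apply: cvgMl_tmp; exact: cvg_exprM_expRN.
- rewrite PE /G expr0n mul0r mulr0 oppr0 add0r factS natrM [in RHS]exprS; field.
  by rewrite expf_neq0// andbT.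
Qed.

Lemma integral_exprM_expRN (R : realType) (k : nat) (p : R) : 0 < p ->
  (\int[lebesgue_measure]_(s in `]0%R, +oo[) (s ^+ k * expR (- (p * s)))%:E =
   (k`!%:R / p ^+ k.+1)%:E)%E.
Proof.
move=> p0; have [P [dP P0 PE]] := exprM_expRN_primitive k p0.
pose f (s : R) := s ^+ k * expR (- (p * s)).
have dP1 (s : R) : derivable P s 1 by have [] := dP s.
have cf : continuous f.
  move=> s; apply: cvgM; first exact: exprn_continuous.
  apply: continuous_comp; last exact: continuous_expR.
  by apply: cvgN; apply: cvgMl_tmp.
rewrite integral_itv_obnd_cbnd; last first.
  by apply/measurable_EFinP; apply: measurable_funTS; exact: continuous_measurable_fun.
rewrite (@ge0_continuous_FTC2y _ f P 0 0)//.
- by rewrite sub0e PE EFinN oppeK.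
- by move=> s s0; rewrite mulr_ge0 ?expR_ge0// exprn_ge0.
- exact: continuous_subspaceT.
- have : {for 0, continuous P}.
    by apply: differentiable_continuous; apply/derivable1_diffP; exact: dP1.
  exact: cvg_at_right_filter.
- by move=> s _; rewrite derive1E; have [_ ->] := dP s.
Qed.

Lemma integral_shift_itvoy (R : realType) (x : R) (G : R -> R) :
  {within `[x, +oo[, continuous G} -> (forall s, x < s -> 0 <= G s) ->
  (\int[lebesgue_measure]_(y in `]0%R, +oo[) (G (x + y))%:E =
   \int[lebesgue_measure]_(s in `]x, +oo[) (G s)%:E)%E.
Proof.
move=> cG G0.
have mG : measurable_fun (`]x, +oo[ : set R) G.
  apply: open_continuous_measurable_fun => //.
  by move: cG => /continuous_within_itvcyP[/in_continuous_mksetP].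
pose F (y : R) := x + y.
have dF (y : R) : is_derive y 1 F 1.
  by rewrite (_ : F = cst x + id)//; apply: is_derive_eq; rewrite add0r.
have F' : F^`()%classic = cst 1 by apply/funext => y; rewrite derive1E; have [_ ->] := dF y.
rewrite [RHS]integral_itv_obnd_cbnd; last exact/measurable_EFinP.
rewrite integral_itv_obnd_cbnd; last first.
  apply/measurable_EFinP.
  have mF : measurable_fun (`]0%R, +oo[ : set R) F by apply: measurable_funTS; exact: measurable_funD.
  apply: (measurable_comp _ _ mG mF) => //.
  by move=> _ [y + <-]; rewrite /F /= !in_itv/= !andbT ltrDl.
have F0 : F 0 = x by rewrite /F addr0.
rewrite -[in RHS]F0 (@increasing_ge0_integration_by_substitutiony _ F G 0).
- by apply: eq_integral => y _; rewrite F' /= mulr1.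
- by move=> y z _ _; rewrite /F ltrD2l.
- by rewrite F' => y _; exact: cvg_cst.
- by rewrite F'; exact: is_cvg_cst.
- by rewrite F'; exact: is_cvg_cst.
- split; first by move=> y _; have [] := dF y.
  have : {for 0, continuous F}.
    by apply: differentiable_continuous; apply/derivable1_diffP; have [] := dF 0.
  exact: cvg_at_right_filter.
- exact: cvg_addrl.
- by rewrite F0.
- by move=> y; rewrite F0 in_itv/= andbT; exact: G0.
Qed.

Lemma integral_parabola (R : realType) (s : R) : 0 < s ->
  (\int[lebesgue_measure]_(x in `]0%R, s[) (x * (s - x))%:E = (s ^+ 3 / 6)%:E)%E.
Proof.
move=> s0.
pose f (x : R) := x * (s - x).
pose F (x : R) := s / 2 * x ^+ 2 - 3^-1 * x ^+ 3.
have cf : continuous f.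
  by move=> x; apply: cvgM; [exact: cvg_id|apply: cvgB; [exact: cvg_cst|exact: cvg_id]].
have dX n (x : R) : is_derive x 1 (fun z : R => z ^+ n.+1) (n.+1%:R * x ^+ n).
  rewrite (_ : (fun z : R => z ^+ n.+1) = id ^+ n.+1); last by apply/funext => z; rewrite fctE.
  by apply: is_derive_eq; rewrite -[_ *: _]/(_ * _) /= mulr1 -mulr_natl.
have dF (x : R) : is_derive x 1 F (f x).
  have d2 := dX 1 x; have d3 := dX 2 x.
  rewrite (_ : F = (s / 2) \*: (fun z : R => z ^+ 2) - 3^-1 \*: (fun z : R => z ^+ 3)); last first.
    by apply/funext.
  by apply: is_derive_eq; rewrite -![_ *: _]/(_ * _) /f; field.
have cF : continuous F.
  move=> x; apply: differentiable_continuous; apply/derivable1_diffP.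
  by have [] := dF x.
have mf : measurable_fun setT f by exact: continuous_measurable_fun.
rewrite integral_itv_obnd_cbnd; last first.
  by apply/measurable_EFinP; exact: measurable_funTS.
rewrite integral_itv_bndo_bndc; last first.
  by apply/measurable_EFinP; exact: measurable_funTS.
rewrite (@continuous_FTC2 _ f F 0 s)//.
- by rewrite -EFinB /F; congr (_ %:E); field.
- exact: continuous_subspaceT.
- split.
  + by move=> x _; have [] := dF x.
  + by apply: cvg_at_right_filter; exact: cF.
  + by apply: cvg_at_left_filter; exact: cF.
- by move=> x _; rewrite derive1E; have [_ ->] := dF x.
Qed.

(* Substitute [s = x + y] and swap: [s^3 / 6] is the integral of [x (s - x)] over [0 < x < s]. *)
Lemma integral2_mulM_add (R : realType) (w : R -> R) :
  measurable_fun setT w ->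
  (forall x, 0 < x -> {for x, continuous w}) -> (forall s, 0 < s -> 0 <= w s) ->
  (\int[lebesgue_measure]_(x in `]0%R, +oo[)
     \int[lebesgue_measure]_(y in `]0%R, +oo[) (x * y * w (x + y))%:E =
   \int[lebesgue_measure]_(s in `]0%R, +oo[) (s ^+ 3 / 6 * w s)%:E)%E.
Proof.
move=> mw cw w0.
pose g (z : R * R) : \bar R :=
  (if (0 < z.1) && (z.1 < z.2) then z.1 * (z.2 - z.1) * w z.2 else 0)%:E.
have g0 z : (0 <= g z)%E.
  rewrite /g lee_fin; case: ifP => // /andP[z1 z12].
  rewrite mulr_ge0 ?w0 ?(lt_trans z1)// mulr_ge0 ?(ltW z1)//.
  by rewrite subr_ge0 ltW.
have mg : measurable_fun setT g.
  apply/measurable_EFinP; apply: measurable_fun_ifT => //.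
    by apply: measurable_and; apply: measurable_fun_ltr.
  apply: measurable_funM; last by exact: measurableT_comp.
  by apply: measurable_funM => //; exact: measurable_funB.
transitivity (\int[lebesgue_measure]_x \int[lebesgue_measure]_s g (x, s))%E.
  rewrite integral_mkcond; apply: eq_integral => x _.
  rewrite patchE mem_setE in_itv/= andbT; case: ifPn => x0; last first.
    by rewrite integral0_eq// => s _; rewrite /g /= (negbTE x0).
  pose G (s : R) := x * (s - x) * w s.
  transitivity (\int[lebesgue_measure]_(y in `]0%R, +oo[) (G (x + y))%:E)%E.
    apply: eq_integral => y _; rewrite /G; congr (_ %:E).
    by congr (_ * _ * _); ring.
  rewrite integral_shift_itvoy; last 2 first.
  - have cG s : 0 < s -> {for s, continuous G}.
      move=> s0; apply: cvgM; last exact: cw.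
      by apply: cvgMl_tmp; apply: cvgB; [exact: cvg_id|exact: cvg_cst].
    apply/continuous_within_itvcyP; split.
      by move=> s; rewrite in_itv/= andbT => xs; apply: cG; exact: lt_trans xs.
    by apply: cvg_at_right_filter; exact: cG.
  - move=> s xs; rewrite /G mulr_ge0 ?w0 ?(lt_trans x0)//.
    by rewrite mulr_ge0 ?(ltW x0)// subr_ge0 ltW.
  rewrite integral_mkcond; apply: eq_integral => s _.
  rewrite patchE mem_setE in_itv/= andbT /g /= x0 /=.
  by case: ifP.
rewrite (@fubini_tonelli _ _ _ _ R (@lebesgue_measure R) (@lebesgue_measure R) g mg g0) [RHS]integral_mkcond; apply: eq_integral => s _.
rewrite patchE mem_setE in_itv/= andbT; case: ifPn => s0; last first.
  rewrite integral0_eq// => x _; rewrite /g /=; case: ifP => // /andP[x0 xs].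
  by rewrite (lt_trans x0 xs) in s0.
transitivity (\int[lebesgue_measure]_(x in `]0%R, s[) ((w s)%:E * (x * (s - x))%:E))%E.
  rewrite [RHS]integral_mkcond; apply: eq_integral => x _.
  rewrite patchE mem_setE in_itv/= /g /=; case: ifP => // _.
  by rewrite -EFinM mulrC.
rewrite ge0_integralZl//.
- by rewrite integral_parabola// -EFinM mulrC.
- apply/measurable_EFinP; apply: measurable_funTS; apply: measurable_funM => //.
  exact: measurable_funB.
- move=> x; rewrite /= in_itv/= => /andP[x0 xs].
  by rewrite lee_fin mulr_ge0 ?(ltW x0)// subr_ge0 ltW.
- by rewrite lee_fin w0.
Qed.

Lemma ln2_le (R : realType) : ln 2 <= 7 / 10 :> R.
Proof.
rewrite -ler_expR lnK ?posrE//.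
have x0 : 0 <= 7 / 10 :> R by lra.
have : series (exp_coeff (7 / 10)) 4 <= expR (7 / 10) :> R.
  apply: nondecreasing_cvgn_le; last exact: is_cvg_series_exp_coeff.
  by apply: nondecreasing_series => n _ _; exact: exp_coeff_ge0.
apply: le_trans; rewrite /series/= !big_nat_recr//= big_nil.
change (2 <= 0 + (7 / 10) ^+ 0 / 1%:R + (7 / 10) ^+ 1 / 1%:R +
  (7 / 10) ^+ 2 / 2%:R + (7 / 10) ^+ 3 / 6%:R :> R).
by rewrite expr0 expr1 !exprS expr0; lra.
Qed.

Lemma zeta_sqr_ge (R : realType) (s : R) : 0 < s ->
  (1 + expR (- (7 / 10 * s)) * (s^-1 + 1 / 4)) ^+ 2 - 1 <= zeta (1 + s) `^ 2 - 1.
Proof.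
move=> s0; have z1 := zeta_ge1 s0.
have c0 : 0 <= s^-1 + 1 / 4 by rewrite addr_ge0// invr_ge0 ltW.
rewrite powR_mulrn ?(le_trans ler01)// lerD2r.
have h : 1 + expR (- (7 / 10 * s)) * (s^-1 + 1 / 4) <= zeta (1 + s).
  apply: le_trans (zeta_ge s0); rewrite [1 / s]div1r lerD2l; apply: ler_wpM2r => //.
  rewrite /powR pnatr_eq0 /= ler_expR mulNr lerN2 mulrC ler_pM2r//.
  exact: ln2_le.
apply: lerXn2r => //; rewrite nnegrE; last exact: le_trans z1.
by rewrite addr_ge0// mulr_ge0// expR_ge0.
Qed.

Definition has_integral_pos (R : realType) (f : R -> R) (A : R) : Prop :=
  [/\ measurable_fun setT f, forall x, 0 < x -> 0 <= f x &
     (\int[lebesgue_measure]_(x in `]0%R, +oo[) (f x)%:E = A%:E)%E].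

Lemma has_integral_pos_lin (R : realType) (c A B : R) (f g : R -> R) : 0 <= c ->
  has_integral_pos f A -> has_integral_pos g B ->
  has_integral_pos (fun x => c * f x + g x) (c * A + B).
Proof.
move=> c0 [mf f0 fA] [mg g0 gB]; split.
- by apply: measurable_funD => //; exact: measurable_funM.
- by move=> x x0; rewrite addr_ge0 ?g0// mulr_ge0// f0.
rewrite EFinD EFinM -fA -gB -ge0_integralZl//; last 2 first.
- by apply/measurable_EFinP; exact: measurable_funTS.
- by move=> x; rewrite /= in_itv/= andbT lee_fin; exact: f0.
rewrite -ge0_integralD//.
- by move=> x; rewrite /= in_itv/= andbT => x0; rewrite -EFinM lee_fin mulr_ge0// f0.
- by apply/measurable_EFinP; apply: measurable_funTS; exact: measurable_funM.
- by move=> x; rewrite /= in_itv/= andbT lee_fin; exact: g0.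
- by apply/measurable_EFinP; exact: measurable_funTS.
Qed.

Lemma has_integral_pos_exprM_expRN (R : realType) (k : nat) (p : R) : 0 < p ->
  has_integral_pos (fun s => s ^+ k * expR (- (p * s))) (k`!%:R / p ^+ k.+1).
Proof.
move=> p0; split; last exact: integral_exprM_expRN.
- apply: measurable_funM; first exact: measurable_funX.
  by apply: measurableT_comp => //; apply: measurableT_comp => //; exact: measurable_funM.
- by move=> s s0; rewrite mulr_ge0 ?expR_ge0// exprn_ge0// ltW.
Qed.

(* The factor [18/5] gives [test_fun] norm 1. *)
Definition test_fun (R : realType) (x : R) : R :=
  if 0 < x then 18 / 5 * (Num.sqrt x * expR (- (9 / 5 * x))) else 0.

(* [(18/5)^2 exp(-9s/5) ((1 + exp(-7s/10) (1/s + 1/4))^2 - 1)], expanded so that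
   [s^3 * test_weight s] is a combination of terms [s^k exp(-ps)]. *)
Definition test_weight (R : realType) (s : R) : R :=
  324 / 25 * (2 * (expR (- (5 / 2 * s)) * (s `^ (-1) + 1 / 4)) +
    expR (- (16 / 5 * s)) * (s `^ (-1) + 1 / 4) ^+ 2).

Lemma test_fun_ge0 (R : realType) (x : R) : 0 <= test_fun x.
Proof.
by rewrite /test_fun; case: ifP => // _; do ![done | apply: mulr_ge0]; exact: sqrtr_ge0.
Qed.

Lemma measurable_test_fun (R : realType) : measurable_fun setT (@test_fun R).
Proof.
apply: measurable_fun_ifT => //; first exact: measurable_fun_ltr.
apply: measurable_funM => //; apply: measurable_funM.
  by apply: continuous_measurable_fun; exact: sqrt_continuous.
by apply: measurableT_comp => //; apply: measurableT_comp => //; exact: measurable_funM.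
Qed.

Lemma integral_test_fun_sqr (R : realType) :
  (\int[lebesgue_measure]_(x in `]0%R, +oo[) (@test_fun R x ^+ 2)%:E = 1)%E.
Proof.
have p0 : 0 < 18 / 5 :> R by lra.
have z : has_integral_pos (cst 0 : R -> R) 0.
  by split => //; rewrite integral0.
have c0 : 0 <= 324 / 25 :> R by lra.
have [_ _] := has_integral_pos_lin c0 (has_integral_pos_exprM_expRN 1 p0) z.
have -> : 324 / 25 * (1`!%:R / (18 / 5) ^+ 2) + 0 = 1 :> R by rewrite !factS fact0; field.
move=> <-; apply: eq_integral => x; rewrite inE/= in_itv/= andbT => x0.
rewrite /test_fun x0 /= addr0 expr1; congr (_ %:E).
rewrite !exprMn sqr_sqrtr ?(ltW x0)// -expRM_natl.
have -> : 2 * - (9 / 5 * x) = - (18 / 5 * x) by field.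
by field.
Qed.

Lemma test_weight_ge0 (R : realType) (s : R) : 0 < s -> 0 <= test_weight s.
Proof.
move=> s0; have c0 : 0 <= s `^ (-1) + 1 / 4 by rewrite addr_ge0 ?powR_ge0.
rewrite /test_weight; apply: mulr_ge0; first by lra.
apply: addr_ge0.
  by rewrite mulr_ge0// mulr_ge0 ?expR_ge0.
by rewrite mulr_ge0 ?expR_ge0// exprn_ge0.
Qed.

Lemma measurable_test_weight (R : realType) : measurable_fun setT (@test_weight R).
Proof.
have me (p : R) : measurable_fun setT (fun s : R => expR (- (p * s))).
  by apply: measurableT_comp => //; apply: measurableT_comp => //; exact: measurable_funM.
have mi : measurable_fun setT (fun s : R => s `^ (-1) + 1 / 4).
  by apply: measurable_funD => //; exact: measurable_powR.
apply: measurable_funM => //; apply: measurable_funD.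
  by apply: measurable_funM => //; apply: measurable_funM.
by apply: measurable_funM => //; apply: measurable_funX.
Qed.

Lemma continuous_test_weight (R : realType) (s : R) : 0 < s ->
  {for s, continuous (@test_weight R)}.
Proof.
move=> s0.
have ce (p : R) : {for s, continuous (fun s : R => expR (- (p * s)))}.
  apply: continuous_comp; last exact: continuous_expR.
  by apply: cvgN; apply: cvgMl_tmp.
have ci : {for s, continuous (fun s : R => s `^ (-1) + 1 / 4)}.
  have : {for s, continuous (fun s : R => s `^ (-1))}.
    apply: differentiable_continuous; apply/derivable1_diffP.
    by apply: derivable_powR; rewrite in_itv/= andbT.
  by move=> h; apply: cvgD; [exact: h|exact: cvg_cst].
apply: cvgMl_tmp; apply: cvgD.
  by apply: cvgMl_tmp; apply: cvgM; [exact: ce|exact: ci].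
by apply: cvgM; [exact: ce|apply: cvgM; exact: ci].
Qed.

Lemma integral_test_weight_gt1 (R : realType) :
  (1 < \int[lebesgue_measure]_(s in `]0%R, +oo[) (s ^+ 3 / 6 * @test_weight R s)%:E)%E.
Proof.
have p0 : 0 < 5 / 2 :> R by lra.
have q0 : 0 < 16 / 5 :> R by lra.
have z : has_integral_pos (cst 0 : R -> R) 0.
  by split => //; rewrite integral0.
have c1 : 0 <= 108 / 25 :> R by lra.
have c2 : 0 <= 27 / 25 :> R by lra.
have c3 : 0 <= 54 / 25 :> R by lra.
have c5 : 0 <= 27 / 200 :> R by lra.
have [_ _] := has_integral_pos_lin c1 (has_integral_pos_exprM_expRN 2 p0)
  (has_integral_pos_lin c2 (has_integral_pos_exprM_expRN 3 p0)
  (has_integral_pos_lin c3 (has_integral_pos_exprM_expRN 1 q0)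
  (has_integral_pos_lin c2 (has_integral_pos_exprM_expRN 2 q0)
  (has_integral_pos_lin c5 (has_integral_pos_exprM_expRN 3 q0) z)))).
set v := (X in _ = X%:E) => H.
rewrite (_ : \int[_]_(_ in _) _ = v%:E)%E; last first.
  rewrite -H; apply: eq_integral => s; rewrite inE/= in_itv/= andbT => s0.
  congr (_ %:E); rewrite /test_weight powR_inv1 ?(ltW s0)// expr1 addr0.
  by field; rewrite gt_eqF.
rewrite lte_fin /v !factS fact0 -!exprVn !invf_div.
have -> : (5 / 16) ^+ 3 = (5 / 16) ^+ 2 * (5 / 16) :> R by rewrite exprSr.
have -> : (5 / 16) ^+ 4 = (5 / 16) ^+ 2 * (5 / 16) ^+ 2 :> R by rewrite -exprD.
have t2 : 39 / 400 <= (5 / 16) ^+ 2 :> R by rewrite expr2; lra.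
have t4 : 1 / 12 * (1 / 12) <= (5 / 16) ^+ 2 * (5 / 16) ^+ 2 :> R.
  by apply: ler_pM => //; lra.
move: t2 t4; set t := (5 / 16) ^+ 2; set tt := t * t => t2 t4.
have -> : (2 / 5) ^+ 3 = 8 / 125 :> R by field.
have -> : (2 / 5) ^+ 4 = 16 / 625 :> R by field.
by lra.
Qed.

Lemma test_kernel_ge (R : realType) (x y : R) : 0 < x -> 0 < y ->
  x * y * test_weight (x + y) <= kernelK0 2 (x, y) * test_fun y * test_fun x.
Proof.
move=> x0 y0; have s0 := addr_gt0 x0 y0.
have zs := zeta_sqr_ge s0.
rewrite kernelK0E// /kernelK /test_fun x0 y0.
have -> : 1 + x + y = 1 + (x + y) by rewrite addrA.
have -> : (2 - 1) / 2 = 2^-1 :> R by field.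
rewrite powR12_sqrt ?mulr_ge0 ?(ltW x0) ?(ltW y0)// sqrtrM ?(ltW x0)//.
set Z := zeta _ `^ 2 - 1.
have -> : Num.sqrt x * Num.sqrt y * Z * (18 / 5 * (Num.sqrt y * expR (- (9 / 5 * y)))) *
    (18 / 5 * (Num.sqrt x * expR (- (9 / 5 * x)))) =
  324 / 25 * (Num.sqrt x ^+ 2 * Num.sqrt y ^+ 2 * (expR (- (9 / 5 * x)) * expR (- (9 / 5 * y))) * Z).
  by field.
rewrite (sqr_sqrtr (ltW x0)) (sqr_sqrtr (ltW y0)) -expRD.
have -> : - (9 / 5 * x) + - (9 / 5 * y) = - (9 / 5 * (x + y)) by field.
rewrite /test_weight powR_inv1 ?(ltW s0)//.
have -> : - (5 / 2 * (x + y)) = - (9 / 5 * (x + y)) + - (7 / 10 * (x + y)) by field.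
have -> : - (16 / 5 * (x + y)) = - (9 / 5 * (x + y)) + - (7 / 10 * (x + y)) + - (7 / 10 * (x + y)) by field.
rewrite !expRD; move: zs; rewrite -/Z.
set e := expR (- (9 / 5 * _)); set a := expR (- (7 / 10 * _)); set t := _^-1 + _ => zs.
have -> : x * y * (324 / 25 * (2 * (e * a * t) + e * a * a * t ^+ 2)) =
  324 / 25 * (x * y * e * ((1 + a * t) ^+ 2 - 1)) by field.
apply: ler_wpM2l; first by lra.
by apply: ler_wpM2l => //; rewrite mulr_ge0 ?expR_ge0// mulr_ge0 ?(ltW x0)// ltW.
Qed.

Lemma test_fun_absK_gt1 (R : realType) :
  (1 < \int[lebesgue_measure]_x (absK 2 (@test_fun R) x * (test_fun x)%:E))%E.
Proof.
apply: lt_le_trans (integral_test_weight_gt1 R) _.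
have mk := @measurable_kernelK0M R 2 _ (@measurable_test_fun R).
have k0 (z : R * R) : 0 <= kernelK0 2 z by exact: kernelK0_ge0.
have t0 := @test_fun_ge0 R.
have mt := @measurable_test_fun R.
rewrite -integral2_mulM_add; last 3 first.
- exact: measurable_test_weight.
- exact: continuous_test_weight.
- exact: test_weight_ge0.
pose g (z : R * R) := if (0 < z.1) && (0 < z.2) then z.1 * z.2 * test_weight (z.1 + z.2) else 0.
have mg : measurable_fun setT (EFin \o g).
  apply/measurable_EFinP; apply: measurable_fun_ifT => //.
    by apply: measurable_and; apply: measurable_fun_ltr.
  apply: measurable_funM; first exact: measurable_funM.
  apply: (measurableT_comp (@measurable_test_weight R)); exact: measurable_funD.
have g0 z : 0 <= g z.
  rewrite /g; case: ifP => // /andP[x0 y0].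
  by rewrite mulr_ge0 ?test_weight_ge0 ?addr_gt0// mulr_ge0 ?(ltW x0)// ltW.
have gk x y : g (x, y) <= kernelK0 2 (x, y) * test_fun y * test_fun x.
  rewrite /g /=; case: ifP => [/andP[x0 y0]|_]; first exact: test_kernel_ge.
  by rewrite mulr_ge0// mulr_ge0.
have -> : (\int[lebesgue_measure]_(x in `]0%R, +oo[)
     \int[lebesgue_measure]_(y in `]0%R, +oo[) (x * y * test_weight (x + y))%:E =
  \int[lebesgue_measure]_x \int[lebesgue_measure]_y (EFin \o g) (x, y))%E.
  rewrite integral_mkcond; apply: eq_integral => x _.
  rewrite patchE mem_setE in_itv/= andbT; case: ifPn => x0.
    rewrite integral_mkcond; apply: eq_integral => y _.
    by rewrite patchE mem_setE in_itv/= andbT /g /= x0 /=; case: ifP.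
  by rewrite integral0_eq// => y _; rewrite /g /= (negbTE x0).
apply: ge0_le_integral => //.
- by move=> x _; apply: integral_ge0 => y _; rewrite lee_fin.
- exact: (@measurable_fun_fubini_tonelli_F _ _ _ _ R (@lebesgue_measure R) (EFin \o g)).
- by apply: emeasurable_funM; [exact: measurable_absK|exact/measurable_EFinP].
move=> x _; rewrite /absK -ge0_integralZr//; last 2 first.
- by apply: measurableT_comp => //; exact: measurable_kernelK0_section.
- by rewrite lee_fin.
apply: ge0_le_integral => //.
- by move=> y _; rewrite lee_fin.
- by apply/(measurableT_comp mg).
- apply: emeasurable_funM => //.
  by apply: measurableT_comp => //; exact: measurable_kernelK0_section.
by move=> y _; rewrite gee0_abs ?lee_fin ?mulr_ge0// -EFinM lee_fin.
Qed.

Lemma opnorm_K2_gt1 (R : realType) : (1 < opnorm (K (2 : R)))%E.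
Proof.
have a1 : 1 < 2 :> R by rewrite ltr1n.
have mt := @measurable_test_fun R.
have n1 : norm2 (@test_fun R) = 1%E.
  by rewrite norm2E// integral_test_fun_sqr poweR1r.
have tL2 : @test_fun R \in L2 by apply/L2P; rewrite n1 ltry.
have mK := measurable_K 2 mt.
have mKt : measurable_fun setT (fun x => (K 2 (@test_fun R) x * test_fun x)%:E).
  by apply/measurable_EFinP; exact: measurable_funM.
have h1 : (1 < \int[lebesgue_measure]_x `|(K 2 (@test_fun R) x * test_fun x)%:E|)%E.
  apply: lt_le_trans (test_fun_absK_gt1 R) _; apply: ae_ge0_le_integral => //.
  - by move=> x _; rewrite mule_ge0 ?absK_ge0// lee_fin test_fun_ge0.
  - by apply: emeasurable_funM; [exact: measurable_absK|exact/measurable_EFinP].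
  - exact: measurableT_comp.
  have FF := @ae_filter_ringOfSetsType _ _ _ (@lebesgue_measure R).
  apply: filterS (ae_absK_lty a1 tL2) => x Ax _.
  have <- : (K 2 (@test_fun R) x)%:E = absK 2 (@test_fun R) x.
    rewrite KE [in LHS](_ : \int[_]_y _ = absK 2 (@test_fun R) x)%E; last first.
      apply: eq_integral => y _.
      by rewrite gee0_abs// lee_fin mulr_ge0 ?test_fun_ge0 ?kernelK0_ge0.
    by rewrite fineK// ge0_fin_numE ?absK_ge0.
  by rewrite -EFinM lee_abs.
have cs := cauchy_schwarz_integral (@lebesgue_measure R) mK mt.
have off (f : R -> R) : (forall x, x <= 0 -> f x = 0) ->
    (\int[lebesgue_measure]_x (f x ^+ 2)%:E = \int[lebesgue_measure]_(x in `]0%R, +oo[) (f x ^+ 2)%:E)%E.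
  move=> f0; rewrite [RHS]integral_mkcond; apply: eq_integral => x _.
  rewrite patchE mem_setE in_itv/= andbT; case: ifPn => // x0.
  by rewrite f0 ?expr0n// leNgt.
have K0 (x : R) : x <= 0 -> K 2 (@test_fun R) x = 0.
  by move=> x0; rewrite /K patchE mem_setE in_itv/= andbT ltNge x0.
have t0 (x : R) : x <= 0 -> test_fun x = 0 by move=> x0; rewrite /test_fun ltNge x0.
rewrite (off _ K0) (off _ t0) integral_test_fun_sqr mule1 in cs.
have h2 : (1 < \int[lebesgue_measure]_(x in `]0%R, +oo[) (K 2 (@test_fun R) x ^+ 2)%:E)%E.
  apply: lt_le_trans cs; rewrite -[ltLHS]mule1.
  apply: (@lt_le_trans _ _ (\int[lebesgue_measure]_x `|(K 2 (@test_fun R) x * test_fun x)%:E| * 1)%E).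
    by rewrite !mule1.
  by apply: lee_pmul => //; [apply: integral_ge0|exact: ltW].
have h3 : (1 < norm2 (K 2 (@test_fun R)))%E.
  rewrite norm2E//; move: h2; case: (\int[_]_(_ in _) _)%E => [r| |]//.
    rewrite lte_fin => r1; rewrite poweR_EFin lte_fin powR12_sqrt ?(le_trans ler01 (ltW r1))//.
    by rewrite -[ltLHS]sqrtr1 ltr_sqrt// (lt_trans ltr01).
  by move=> _; rewrite poweRyr ?ltry// invr_eq0 pnatr_eq0.
apply: (lt_le_trans h3); apply: ereal_sup_ubound.
by exists (@test_fun R) => //; split => //; rewrite n1.
Qed.

Lemma Gamma_fact (R : realType) (n : nat) : Gamma (n.+1%:R : R) = n`!%:R.
Proof.
have := @integral_exprM_expRN R n 1 ltr01; rewrite expr1n divr1 /Gamma /Rintegral => H.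
rewrite (_ : \int[_]_(_ in _) _ = n`!%:R%:E)%E// -H.
apply: eq_integral => t; rewrite inE/= in_itv/= andbT => t0.
by rewrite -natr1 addrK powR_mulrn ?(ltW t0)// mul1r.
Qed.

Lemma Lambda2 (R : realType) : Lambda (2 : R) = 1.
Proof.
have G1 := @Gamma_fact R 0; have G2 := @Gamma_fact R 1.
by rewrite /Lambda divff ?pnatr_eq0// G1 G2 expr1n divr1.
Qed.

Theorem lemma4p4 (R : realType) :
  (forall alpha : R, 1 < alpha ->
     (forall F : R -> R, F \in L2 ->
        {ae mu_pos, forall x, lebesgue_measure.-integrable `]0%R, +oo[
                                (fun y => (kernelK alpha x y * F y)%:E)}) /\
     bounded_operator (K alpha)) /\
  ((Lambda (2 : R))%:E < opnorm (K (2 : R)))%E /\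
  Lambda (2 : R) = 1 /\
  (E : set R) !=set0.
Proof.
split=> [alpha a1|].
  split; last exact: K_bounded.
  move=> F F2; have [mF _] := (L2P F).1 F2; apply: ae_mu_pos.
  have FF := @ae_filter_ringOfSetsType _ _ _ (@lebesgue_measure R).
  by apply: filterS (ae_absK_lty a1 F2) => x Fx x0; exact: kernelK_integrable.
have K2 := opnorm_K2_gt1 R.
rewrite Lambda2; split=> //; split=> //.
by exists 2; rewrite /E /= Lambda2 ltr1n.
Qed.
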